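(* Let $n \geq 2$ and $m \geq 1$ be integers and let $h = \lfloor n(m+1)/2 \rfloor$. Let $S(m,n)$ be the size of the largest antichains in the product poset $[m]^n$. If $n(m+1)$ is even, then $$S(m,n) = m^{n-1} - 2 \sum_{r=n-1}^{h-m-1} \ \sum_{i=0}^{\left\lfloor \frac{r-n+1}{m-1} \right\rfloor} (-1)^{i} \binom{n-1}{i} \binom{r-im-1}{r-im-n+1}.$$ Otherwise (that is, if $n(m+1)$ is odd), $$S(m,n) = m^{n-1} - 2 \sum_{r=n-1}^{h-m-1} \ \sum_{i=0}^{\left\lfloor \frac{r-n+1}{m-1} \right\rfloor} (-1)^{i} \binom{n-1}{i} \binom{r-im-1}{r-im-n+1} - \sum_{i=0}^{\left\lfloor \frac{h-m-n+1}{m-1} \right\rfloor} (-1)^{i} \binom{n-1}{i} \binom{h-m-im-1}{h-m-im-n+1}.$$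
   Context: For a positive integer $m$, $[m] = \{1, \ldots, m\}$ with its usual linear order, and $[m]^n$ is ordered componentwise: $x \preceq y$ if and only if $x_i \leq y_i$ for all $i \in \{1,\ldots,n\}$. An antichain is a subset of pairwise incomparable elements (no two distinct elements are comparable). $S(m,n)$ denotes the maximal cardinality of an antichain in $([m]^n, \preceq)$. Conventions: a sum whose upper limit is smaller than its lower limit is empty and equals $0$ (in particular, for $m=1$ the outer sum over $r$ is empty, so the quotient by $m-1$ never has to be evaluated). A binomial coefficient $\binom{a}{b}$ with $b<0$ equals $0$ (for any integer $a$, including negative $a$), and $\binom{n-1}{i} = 0$ for $i > n-1$. *)

(* Defs.v *)
From HB Require Import structures.
From mathcomp Require Import all_boot all_order all_algebra.

Set Implicit Arguments.
Unset Strict Implicit.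
Unset Printing Implicit Defensive.

Import Order.TTheory GRing.Theory Num.Theory.

Definition antichain (d : Order.disp_t) (T : finPOrderType d) (A : {set T}) :=
  [forall x in A, forall y in A, (x != y) ==> (x >< y)%O].

(* The chain {1, ..., m} is represented by 'I_m = {0, ..., m - 1}, in order;
   n.-tupleprod carries the componentwise order. *)
Definition max_antichain (m n : nat) : nat :=
  \max_(A : {set n.-tupleprod 'I_m} | antichain A) #|A|.

Local Open Scope ring_scope.

(* Integer binomial coefficient, a (a - 1) ... (a - b + 1) / b! for b >= 0
   (an exact division) and 0 for b < 0. *)
Definition binz (a b : int) : int :=
  if b is Posz k then ((\prod_(j < k) (a - j%:Z)) %/ k`!%:Z)%Z else 0.

(* The sum of F over the integers i with a <= i <= b; it is empty if b < a. *)
Definition sumz (a b : int) (F : int -> int) : int :=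
  \sum_(k < `|Num.max 0%R (b - a + 1)%R|%N) F (a + k%:Z).

Notation "\sumz_ ( a <= i <= b ) F" := (sumz a b (fun i : int => F))
  (at level 0, F at level 41, i name, a at level 60, b at level 60,
   format "'[' \sumz_ ( a  <=  i  <=  b ) '/  '  F ']'") : ring_scope.

(* Main.v *)
(* Largest antichain: [m]^n has a partition into saturated chains symmetric
   about the middle rank.  Given such a chain C in [m]^n, the grid C x [m] splits
   into symmetric hooks, and the hook containing (x, l) is the one numbered
   min(l, distance from x to the top of C).  An antichain meets each chain at most
   once and the middle layer meets each exactly once, so the middle layer is a
   largest antichain.
   Counting, with coordinates shifted to {0, ..., m - 1}: layer sizes are the
   coefficients of (1 + X + ... + X^(m-1))^n.  Grouping the middle layer by its
   first coordinate turns it into a window of m consecutive layers of [m]^(n-1);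
   removing the two tails from m^(n-1) and using the symmetry of the layers gives
   the formula, and the layer sizes of [m]^(n-1) come from dividing
   (1 - X^m)^(n-1) by (1 - X)^(n-1). *)
Require Import Defs.
From HB Require Import structures.
From mathcomp Require Import all_boot all_order all_algebra.
From mathcomp Require Import zify ring.
Import Order.TTheory GRing.Theory Num.Theory.
Local Open Scope ring_scope.

(* The least element of the chain containing x; it serves as the name of that
   chain, which occupies the ranks from sumn b to size x * k - sumn b. *)
Fixpoint chain_bottom (k : nat) (x : seq nat) : seq nat :=
  if x is l :: x' then
    let b := chain_bottom k x' in
    minn l (size x' * k - sumn b - sumn x') :: b
  else [::].

(** * Symmetric saturated chains, built one coordinate at a time *)

Section ChainBottom.
Local Open Scope nat_scope.
Variable k : nat.
Implicit Types x y : seq nat.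

Lemma size_chain_bottom x : size (chain_bottom k x) = size x.
Proof. by elim: x => //= l x ->. Qed.

Lemma sumn_chain_bottom x : all (leq^~ k) x ->
  sumn (chain_bottom k x) <= sumn x /\
  sumn x + sumn (chain_bottom k x) <= size x * k.
Proof.
elim: x => //= l x IH /andP[lk /IH[IH1 IH2]].
rewrite mulSn; move: (sumn _) (sumn x) (size x * k) IH1 IH2 => b s nk.
by clear -lk; lia.
Qed.

Lemma chain_bottom_comparable x y : all (leq^~ k) x -> all (leq^~ k) y ->
  chain_bottom k x = chain_bottom k y -> sumn x <= sumn y -> all2 leq x y.
Proof.
elim: x y => [|l x IH] [|l' y] //= /andP[lk xk] /andP[l'k yk] [ej eb] le_xy.
have es : size x = size y.
  by rewrite -(size_chain_bottom x) -(size_chain_bottom y) eb.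
have [x1 x2] := sumn_chain_bottom x xk.
have [y1 y2] := sumn_chain_bottom y yk.
move: ej x1 x2 y1 y2 le_xy; rewrite es eb => ej x1 x2 y1 y2 le_xy.
(* A hook keeps the head at its number [j] while the tail climbs to distance [j] from its top, and
   only then raises the head. So head and tail both grow weakly with the total rank. *)
have [-> le_s] : l <= l' /\ sumn x <= sumn y.
  move: ej x1 x2 y1 y2 le_xy; clear.
  move: (size y * k) (sumn (chain_bottom k y)) (sumn x) (sumn y) => nk b s s'.
  lia.
exact: IH.
Qed.

(** The absence of gaps is what forces every chain to meet the middle layer. *)
Lemma chain_bottom_saturated x t : all (leq^~ k) x ->
  sumn (chain_bottom k x) <= t -> t + sumn (chain_bottom k x) <= size x * k ->
  exists y,
    [/\ all (leq^~ k) y, chain_bottom k y = chain_bottom k x & sumn y = t].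
Proof.
elim: x t => [|l x IH] t /=.
  by rewrite mul0n addn0 leqn0 => _ _ /eqP ->; exists [::].
move=> /andP[lk xk]; have [x1 x2] := sumn_chain_bottom x xk.
rewrite mulSn; set b := sumn _ in x1 x2 *; set nk := size x * k in x2 *.
set j := minn l _ => t1 t2.
(* [u] is the rank of the tail on hook [j]: it grows first, up to its cap [nk - b - j], and the head
   [t - u] absorbs the rest. *)
pose u := minn (t - j) (nk - b - j).
have [||y [yk eb su]] := IH u xk; [rewrite -/b; lia| rewrite -/b -/nk; lia|].
exists ((t - u) :: y) => /=.
have es : size y = size x.
  by rewrite -(size_chain_bottom x) -(size_chain_bottom y) eb.
rewrite yk eb su -/b es -/nk; split; [lia | congr (_ :: _); lia | lia].
Qed.

End ChainBottom.

(** * The middle layer as a largest antichain *)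

Section Sperner.
Local Open Scope nat_scope.
Variables k n : nat.
Implicit Types (t u : n.-tupleprod 'I_k.+1) (A : {set n.-tupleprod 'I_k.+1}).

Definition coords t : seq nat :=
  [seq nat_of_ord i | i <- (t : n.-tuple 'I_k.+1)].

Definition layer (s : nat) : {set n.-tupleprod 'I_k.+1} :=
  [set t | sumn (coords t) == s].

Lemma size_coords t : size (coords t) = n.
Proof. by rewrite size_map size_tuple. Qed.

Lemma all_coords t : all (leq^~ k) (coords t).
Proof. by apply/allP => _ /mapP[i _ ->]; rewrite /= -ltnS ltn_ord. Qed.

Lemma nth_coords t (i : 'I_n) : nth 0 (coords t) i = tnth t i.
Proof. by rewrite (nth_map ord0) ?size_tuple // -tnth_nth. Qed.

Lemma coords_surj y : size y = n -> all (leq^~ k) y -> exists t, coords t = y.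
Proof.
move=> sy /allP yk; exists [tuple inord (nth 0 y i) | i < n].
apply: (@eq_from_nth _ 0); rewrite size_coords // => i lt_in.
rewrite -[i]/(val (Ordinal lt_in)) nth_coords tnth_mktuple inordK // ltnS.
by apply/yk/mem_nth; rewrite sy.
Qed.

Lemma le_coords t u : (t <= u)%O = all2 leq (coords t) (coords u).
Proof.
rewrite Order.TupleProdOrder.leEtprod all2E !size_coords eqxx /=.
apply/forallP/(all_nthP (0, 0)) => [le_tu i|le_tu i].
  rewrite size_zip !size_coords minnn => lt_in.
  rewrite nth_zip ?size_coords //= -[i]/(val (Ordinal lt_in)) !nth_coords.
  exact: le_tu.
have := le_tu i; rewrite size_zip !size_coords minnn => /(_ (ltn_ord i)).
by rewrite nth_zip ?size_coords //= !nth_coords.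
Qed.

(** The equality case makes each layer an antichain: comparable elements of equal rank coincide. *)
Lemma all2_leq_sumn (x y : seq nat) :
  all2 leq x y -> sumn x <= sumn y ?= iff (x == y).
Proof.
elim: x y => [|a x IH] [|b y] //= /andP[le_ab /IH le_xy].
by rewrite eqseq_cons; apply: leqif_add => //; apply/leqifP; case: ltngtP le_ab.
Qed.

Lemma coords_inj : injective coords.
Proof.
move=> t u etu; apply: eq_from_tnth => i; apply: val_inj.
by rewrite /= -!nth_coords etu.
Qed.

Lemma antichain_layer s : antichain (layer s).
Proof.
apply/forall_inP => t; rewrite inE => /eqP st.
apply/forall_inP => u; rewrite inE => /eqP su; apply/implyP.
apply: contraNT; rewrite negbK => ctu.
wlog le_tu : t u st su {ctu} / (t <= u)%O => [th|].
  by case/orP: ctu => /th; [apply | rewrite eq_sym; apply].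
move: le_tu; rewrite le_coords => /all2_leq_sumn[_].
by rewrite st su eqxx => /esym/eqP/coords_inj ->.
Qed.

Lemma card_antichain_le A : antichain A -> #|A| <= #|layer ((n * k)./2)|.
Proof.
move=> /forall_inP acA; pose b t := chain_bottom k (coords t).
have b_inj : {in enum A &, injective b}.
  move=> t u; rewrite !mem_enum => At Au ebtu.
  have/forall_inP/(_ u Au)/implyP := acA t At.
  case: eqVneq => // _ /(_ isT) /negP[].
  rewrite /Order.comparable !le_coords.
  have [le_tu|/ltnW le_ut] := leqP (sumn (coords t)) (sumn (coords u)).
    by rewrite (chain_bottom_comparable _ _ _ (all_coords t) (all_coords u)).
  by rewrite orbC (chain_bottom_comparable _ _ _ (all_coords u) (all_coords t)).
have: {subset map b (enum A) <= map b (enum (layer (n * k)./2))}.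
  move=> _ /mapP[t _ ->].
  have [le1 le2] := sumn_chain_bottom k _ (all_coords t).
  rewrite size_coords in le2.
  (* Adding [le1] and [le2] shows that twice the bottom rank is at most [n * k], so the middle rank
     lies in the range of the chain. *)
  have [||y [yk ebt sy]] :=
    chain_bottom_saturated k _ (n * k)./2 (all_coords t).
  - by lia.
  - by rewrite size_coords; lia.
  have [|u eu] := coords_surj y _ yk.
    by rewrite -(size_chain_bottom k y) ebt size_chain_bottom size_coords.
  by apply/mapP; exists u; rewrite ?mem_enum ?inE /b eu ?sy.
move/uniq_leq_size; rewrite map_inj_in_uniq // enum_uniq !size_map -!cardE.
exact.
Qed.

Lemma max_antichain_layer : max_antichain k.+1 n = #|layer ((n * k)./2)|.
Proof.
apply/eqP; rewrite eqn_leq; apply/andP; split.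
  by apply/bigmax_leqP => A; apply: card_antichain_le.
exact/(@leq_bigmax_cond _ _ (fun A : {set _} => #|A|))/antichain_layer.
Qed.

End Sperner.

(** * Layer sizes as polynomial coefficients *)

Definition geom (m : nat) : {poly int} := \sum_(i < m) 'X^i.

Lemma card_layer (k n s : nat) : (#|layer k n s| : int) = (geom k.+1 ^+ n)`_s.
Proof.
have -> : geom k.+1 ^+ n = \prod_(i < n) \sum_(j < k.+1) 'X^j.
  by rewrite prodr_const card_ord.
rewrite bigA_distr_bigA /=.
under eq_bigr => f _ do rewrite prodrXr -['X^_]scale1r.
rewrite coef_sumMXn sumr_const natz; congr _%:Z.
pose g (f : {ffun 'I_n -> 'I_k.+1}) : n.-tupleprod 'I_k.+1 := tuple_of_finfun f.
have g_bij : bijective g.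
  by exists (@finfun_of_tuple _ n); [apply: tuple_of_finfunK|
    apply: finfun_of_tupleK].
rewrite -(on_card_preimset (onW_bij _ g_bij)); apply: eq_card => f.
rewrite !inE unfold_in; congr (_ == _).
by rewrite sumnE big_map big_tuple; apply: eq_bigr => i _; rewrite tnth_mktuple.
Qed.

Lemma coef_1subX_mul (p : {poly int}) (r : nat) :
  (p * (1 - 'X))`_r.+1 = p`_r.+1 - p`_r.
Proof. by rewrite mulrBr mulr1 coefB coefMX. Qed.

(** This is multiplication by the series of [1 / (1 - 'X) ^+ q.+1], done without series: multiplying
    by [1 - 'X] takes differences of coefficients, and Pascal's rule sums them back. *)
Lemma coef_div_1subX (q : nat) (p A : {poly int}) (r : nat) :
  p * (1 - 'X) ^+ q.+1 = A ->
  p`_r = \sum_(j < r.+1) A`_j * ('C(r - j + q, q))%:Z.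
Proof.
elim: q p r => [|q IHq] p r.
  rewrite expr1 => <-; under eq_bigr do rewrite bin0 mulr1.
  elim: r => [|r IHr]; last first.
    by rewrite big_ord_recr -IHr /= coef_1subX_mul addrC subrK.
  by rewrite big_ord1 mulrBr mulr1 coefB coefMX subr0.
rewrite exprS mulrA => eA; elim: r => [|r IHr].
  have := IHq _ 0%N eA; rewrite !big_ord1 /= !binn !mulr1 => <-.
  by rewrite mulrBr mulr1 coefB coefMX subr0.
have := IHq _ r.+1 eA; rewrite coef_1subX_mul IHr => /eqP.
rewrite subr_eq => /eqP ->.
rewrite big_ord_recr [RHS]big_ord_recr /= !subnn !add0n !binn addrAC.
congr (_ + _).
rewrite -big_split /=; apply: eq_bigr => j _; rewrite -mulrDr; congr (_ * _).
have le_jr : (j <= r)%N by rewrite -ltnS.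
by rewrite subSn // addSnnS [in RHS]addSn binS PoszD addrC.
Qed.

(** The guard [i * m <= r] discards the terms in which [r - i * m] would truncate. *)
Lemma coef_geom_exp (m q r : nat) :
  (geom m ^+ q.+1)`_r =
  \sum_(i < q.+2 | (i * m <= r)%N)
     (-1) ^+ i * 'C(q.+1, i)%:Z * 'C(r - i * m + q, q)%:Z.
Proof.
have -> := @coef_div_1subX q (geom m ^+ q.+1) ((1 - 'X^m) ^+ q.+1) r.
  have -> : (1 - 'X^m) ^+ q.+1 =
            \sum_(i < q.+2) ((-1) ^+ i * 'C(q.+1, i)%:Z) *: 'X^(i * m).
    rewrite exprBn; apply: eq_bigr => i _.
    rewrite expr1n mulr1 -exprM mulnC -mulr_natr -mul_polyC rmorphM rmorph_sign.
    by rewrite -natz rmorph_nat mulrAC.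
  under [LHS]eq_bigr => j _ do rewrite coef_sumMXn mulr_suml.
  rewrite (exchange_big_dep predT) //= [RHS]big_mkcond; apply: eq_bigr => i _.
  case: leqP => [le_r|lt_r].
    by rewrite (big_pred1 (Ordinal (le_r : i * m < r.+1)%N)).
  by rewrite big_pred0 // => j; have := ltn_ord j; lia.
by rewrite -exprMn /geom -[1 - 'X]opprB -[1 - 'X^m]opprB subrX1 mulrN mulrC.
Qed.

(** Reversing every coordinate exchanges the two layers. *)
Lemma coef_geom_exp_sym (m q r : nat) : (r <= q * m)%N ->
  (geom m.+1 ^+ q)`_(q * m - r) = (geom m.+1 ^+ q)`_r.
Proof.
move=> le_r; rewrite -!card_layer; congr _%:Z.
pose g (t : q.-tupleprod 'I_m.+1) : q.-tupleprod 'I_m.+1 :=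
  map_tuple (@rev_ord _) t.
have gK : involutive g.
  by move=> t; apply: val_inj; rewrite /= mapK //; apply: (@rev_ordK _).
rewrite -(card_preimset _ (inv_inj gK)); apply: eq_card => t; rewrite !inE.
suff: (sumn (coords _ _ (g t)) + sumn (coords _ _ t) = q * m)%N.
  by move: (sumn _) (sumn _) => a b; lia.
transitivity (size (tval t) * m)%N; last by rewrite size_tuple.
rewrite /coords /=; elim: (tval t) => //= i s IH.
by have := ltn_ord i; rewrite mulSn -IH; lia.
Qed.

(** Evaluation at 1 adds up all coefficients, and none lies beyond degree [q * m]. *)
Lemma sum_coef_geom_exp (m q : nat) :
  \sum_(r < (q * m).+1) (geom m.+1 ^+ q)`_r = m.+1%:Z ^+ q.
Proof.
have <- : (geom m.+1 ^+ q).[1] = m.+1%:Z ^+ q.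
  rewrite horner_exp horner_sum; congr (_ ^+ _).
  by under eq_bigr do rewrite hornerXn expr1n; rewrite sumr_const card_ord natz.
rewrite (@horner_coef_wide _ (q * m).+1).
  by apply: eq_bigr => r _; rewrite expr1n mulr1.
have size_geom : (size (geom m.+1) <= m.+1)%N.
  apply: leq_trans (size_sum _ _ _) _; apply/bigmax_leqP => i _.
  by rewrite size_polyXn ltn_ord.
have := size_exp (geom m.+1) q.
have : ((size (geom m.+1)).-1 * q <= q * m)%N.
  by rewrite mulnC leq_mul2l; apply/orP; right; lia.
by move: (_ * q)%N (q * m)%N (size (geom m.+1 ^+ q)) => a b c; lia.
Qed.

Lemma coef_geomS (k q s : nat) : (k <= s)%N ->
  (geom k.+1 ^+ q.+1)`_s = \sum_(s - k <= r < s.+1) (geom k.+1 ^+ q)`_r.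
Proof.
move=> le_ks; rewrite exprS mulr_suml coef_sum big_rev_mkord /=.
have -> : (s.+1 - (s - k))%N = k.+1 by lia.
apply: eq_bigr => j _; rewrite coefXnM subSS.
by case: ltnP => // lt_sj; have := ltn_ord j; lia.
Qed.

Lemma coef_geom_mid (k q s : nat) : (k <= s <= q * k)%N ->
  (geom k.+1 ^+ q.+1)`_s =
    k.+1%:Z ^+ q - \sum_(r < s - k) (geom k.+1 ^+ q)`_r
                 - \sum_(r < q * k - s) (geom k.+1 ^+ q)`_r.
Proof.
move=> /andP[le_ks le_sD]; rewrite coef_geomS // -sum_coef_geom_exp.
(* Symmetry reflects the upper tail onto the lowest coefficients. *)
have -> : \sum_(r < q * k - s) (geom k.+1 ^+ q)`_r =
          \sum_(s.+1 <= r < (q * k).+1) (geom k.+1 ^+ q)`_r.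
  rewrite big_rev_mkord subSS; apply: eq_bigr => r _ /=.
  by rewrite subSS coef_geom_exp_sym //; have := ltn_ord r; lia.
rewrite -2!(big_mkord xpredT (fun r => (geom k.+1 ^+ q)`_r)).
rewrite (@big_cat_nat _ _ _ (s - k) 0 (q * k).+1) //=; last by lia.
rewrite (@big_cat_nat _ _ _ s.+1 (s - k) (q * k).+1) //=; [ring | lia].
Qed.

(** * The integer binomials and sums of the statement *)

Lemma binz_nat (a b : nat) : binz a%:Z b%:Z = 'C(a, b)%:Z.
Proof.
rewrite /binz bin_ffactd; have -> : \prod_(j < b) (a%:Z - j%:Z) = (a ^_ b)%:Z.
  elim: b => [|b IHb]; first by rewrite big_ord0.
  rewrite big_ord_recr /= IHb ffactnSr PoszM.
  have [le_ba|lt_ab] := leqP b a; first by rewrite subzn.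
  (* The product already contains the factor [a - a], so the truncated [a - b] does no harm. *)
  by rewrite ffact_small ?mul0r.
by rewrite divz_nat.
Qed.

Lemma eq_sum_ord_support (V : nmodType) (a b : nat) (F : nat -> V) :
  (forall i, (a <= i)%N -> F i = 0) -> (forall i, (b <= i)%N -> F i = 0) ->
  \sum_(i < a) F i = \sum_(i < b) F i.
Proof.
wlog le_ab : a b / (a <= b)%N => [th F0a F0b|F0a _].
  by case/orP: (leq_total a b) => le; [|symmetry]; apply: th.
rewrite (big_ord_widen _ F le_ab) big_mkcond; apply: eq_bigr => i _.
by case: ltnP => // /F0a.
Qed.

(** The equations for [N], [M] and [x] let this apply both to the inner sum and to the extra sum of
    the odd case. *)
Lemma sumz_geom_exp (k q r : nat) (N M x : int) : (0 < k)%N ->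
  N = q.+2 -> M = k.+1 -> x = r%:Z + q.+1%:Z ->
  \sumz_(0 <= i <= ((x - N + 1) %/ (M - 1))%Z)
     ((-1) ^ i * binz (N - 1) i * binz (x - i * M - 1) (x - i * M - N + 1))
  = (geom k.+1 ^+ q.+1)`_r.
Proof.
move=> k0 -> -> ->; rewrite /sumz.
have -> : (r%:Z + q.+1%:Z - q.+2%:Z + 1 = r)%R by lia.
have -> : (k.+1%:Z - 1 = k)%R by lia.
rewrite divz_nat.
have -> : `|Num.max 0%R ((r %/ k)%N%:Z - 0 + 1)%R|%N = (r %/ k).+1.
  by case: (r %/ k)%N => *; lia.
rewrite coef_geom_exp [RHS]big_mkcond.
(* [F] vanishes beyond both upper limits: [i > q.+1] kills the first binomial, and [i > r %/ k]
   gives [i * k > r], so the guard fails. *)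
pose F i := if (i * k.+1 <= r)%N
  then (-1) ^+ i * 'C(q.+1, i)%:Z * 'C(r - i * k.+1 + q, q)%:Z else 0.
transitivity (\sum_(i < q.+2) F i); last by [].
rewrite -(@eq_sum_ord_support int (r %/ k).+1 q.+2 F) /F.
- apply: eq_bigr => i _; rewrite add0r -exprnP.
  have -> : (q.+2%:Z - 1 = q.+1)%R by lia.
  rewrite binz_nat; case: leqP => [le_r|lt_r].
    have -> : r%:Z + q.+1%:Z - i%:Z * k.+1%:Z - 1 = (r - i * k.+1 + q)%N by lia.
    have -> : r%:Z + q.+1%:Z - i%:Z * k.+1%:Z - q.+2%:Z + 1
              = (r - i * k.+1)%N by lia.
    by rewrite binz_nat -(bin_sub (leq_addl (r - i * k.+1) q)) addnK.
  (* The lower index is negative here, where [binz] is 0. *)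
  have -> : r%:Z + q.+1%:Z - i%:Z * k.+1%:Z - q.+2%:Z + 1
            = Negz (i * k.+1 - r).-1 by lia.
  by rewrite mulr0.
- move=> i; rewrite /= => lt_i; case: leqP => // le_r.
  have: (i * k <= r)%N by apply: leq_trans le_r; rewrite leq_mul.
  by rewrite -leq_divRL // => le_i; move: lt_i; lia.
- by move=> i le_i; rewrite bin_small ?mulr0 ?mul0r ?if_same.
Qed.

Theorem theorem2 (n m : nat) (hn : (2 <= n)%N) (hm : (1 <= m)%N) :
  let h : int := ((n * (m + 1)) %/ 2)%N in
  let N : int := n in
  let M : int := m in
  (~~ odd (n * (m + 1))%N ->
     (max_antichain m n : int) =
       M ^+ n.-1
       - 2 * (\sumz_(N - 1 <= r <= h - M - 1)
                (\sumz_(0 <= i <= ((r - N + 1) %/ (M - 1))%Z)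
                   ((-1) ^ i * binz (N - 1) i
                    * binz (r - i * M - 1) (r - i * M - N + 1)))))
  /\
  (odd (n * (m + 1))%N ->
     (max_antichain m n : int) =
       M ^+ n.-1
       - 2 * (\sumz_(N - 1 <= r <= h - M - 1)
                (\sumz_(0 <= i <= ((r - N + 1) %/ (M - 1))%Z)
                   ((-1) ^ i * binz (N - 1) i
                    * binz (r - i * M - 1) (r - i * M - N + 1))))
       - (\sumz_(0 <= i <= ((h - M - N + 1) %/ (M - 1))%Z)
            ((-1) ^ i * binz (N - 1) i
             * binz (h - M - i * M - 1) (h - M - i * M - N + 1)))).
Proof.
case: n hn => [|[|q]] // _; case: m hm => // k _.
move=> h N M; rewrite max_antichain_layer card_layer.
set s := ((q.+2 * k)./2)%N.
have le_ks : (k <= s)%N by rewrite /s; lia.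
have le_sD : (s <= q.+1 * k)%N by rewrite /s; lia.
have odd_eq : odd (q.+2 * (k.+1 + 1)) = odd (q.+2 * k) by rewrite !oddM; lia.
(* Starting the coordinates at 0 lowers each rank by [q.+2], which takes [h] to the middle rank
   [s]. *)
have eh : h = (s + q.+2)%N by rewrite /h /s; lia.
have -> : \sumz_(N - 1 <= r <= h - M - 1)
            (\sumz_(0 <= i <= ((r - N + 1) %/ (M - 1))%Z)
               ((-1) ^ i * binz (N - 1) i
                * binz (r - i * M - 1) (r - i * M - N + 1)))
          = \sum_(r < s - k) (geom k.+1 ^+ q.+1)`_r.
  rewrite [LHS]/sumz.
  have -> : `|Num.max 0%R (h - M - 1 - (N - 1) + 1)%R|%N = (s - k)%N.
    by rewrite eh /N /M; lia.
  apply: eq_bigr => r _; apply: sumz_geom_exp => //; last by rewrite /N; lia.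
  (* For [k = 0] the outer sum is empty. *)
  by case: (posnP k) r => // k0; rewrite /s k0 muln0 => -[].
rewrite odd_eq coef_geom_mid ?le_ks //.
split => odd_nk.
  (* Here [2 * s = q.+2 * k], so the two tails have equal length. *)
  have -> : (q.+1 * k - s)%N = (s - k)%N by rewrite /s; lia.
  by rewrite -addrA -opprD mulr2n mulrDl mul1r.
(* Rounding [s] down makes the reflected upper tail one term longer; its last term, of index
   [s - k], is the extra sum. *)
have -> : (q.+1 * k - s)%N = (s - k).+1 by rewrite /s; lia.
rewrite (@sumz_geom_exp k q (s - k)) //; first last.
- by rewrite eh /M; lia.
- by case: (posnP k) odd_nk => // ->; rewrite muln0.
by rewrite big_ord_recr /=; ring.
Qed.
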